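(* Let $A,B\in 2^\omega$. Then $A\le_T B$ if and only if for all $X\in 2^\omega$, $\dim_{si\widehat{\Pi}^0_1(A)}(X)\le\dim_{si\widehat{\Pi}^0_1(B)}(X)$.
   Context: $K(\sigma)$ denotes prefix-free Kolmogorov complexity and $X\upharpoonright n$ the first $n$ bits of $X$. The principal function $p_S$ of an infinite set $S=\{s_0<s_1<\cdots\}$ is $p_S(n)=s_n$. For an oracle $C$, $\widehat{\Pi}^0_1(C)$ denotes the class of infinite sets $S\subseteq\omega$ whose complement is $C$-computably enumerable and whose principal function is bounded above by some $C$-computable function. Then $\dim_{si\widehat{\Pi}^0_1(C)}(X)=\sup_{N\in\widehat{\Pi}^0_1(C)}\inf_{n\in N}K(X\upharpoonright n)/n$. *)

(* Defs.v *)
From Stdlib Require Cantor.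
From HB Require Import structures.
From mathcomp Require Import all_boot all_order all_algebra.
From mathcomp Require Import all_classical all_reals all_analysis.

Set Implicit Arguments.
Unset Strict Implicit.
Unset Printing Implicit Defensive.

Local Open Scope classical_set_scope.

Definition npair (x y : nat) : nat := Cantor.to_nat (x, y).
Definition nfst (z : nat) : nat := (Cantor.of_nat z).1.
Definition nsnd (z : nat) : nat := (Cantor.of_nat z).2.

(* Kleene's mu-recursive functions with an oracle, in unary form: several
   arguments are passed as one number through the Cantor pairing. *)
Inductive oprog : Type :=
  | CZero
  | CSucc
  | CFst
  | CSnd
  | COracle
  | CPair of oprog & oprog
  | CComp of oprog & oprog
  | CRec of oprog & oprog
  | CMu of oprog.

(* [run C c x y]: program [c] with oracle [C] halts on input [x] with
   output [y]. *)
Fixpoint run (C : nat -> bool) (c : oprog) (x y : nat) {struct c} : Prop :=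
  match c with
  | CZero => y = 0
  | CSucc => y = x.+1
  | CFst => y = nfst x
  | CSnd => y = nsnd x
  | COracle => y = nat_of_bool (C x)
  | CPair f g =>
      exists u v, [/\ run C f x u, run C g x v & y = npair u v]
  | CComp f g => exists2 u, run C g x u & run C f u y
  | CRec f g =>
      (fix rec (n z : nat) {struct n} : Prop :=
         match n with
         | 0 => run C f (nfst x) z
         | m.+1 =>
             exists2 u, rec m u & run C g (npair (nfst x) (npair m u)) z
         end) (nsnd x) y
  | CMu f =>
      run C f (npair x y) 0 /\
      forall z, z < y -> exists u, run C f (npair x z) u.+1
  end.

Definition computable_in (C : nat -> bool) (f : nat -> nat) : Prop :=
  exists c, forall n, run C c n (f n).

Definition Turing_le (A B : nat -> bool) : Prop :=
  computable_in B (fun n => nat_of_bool (A n)).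

Definition ce_in (C : nat -> bool) (W : set nat) : Prop :=
  exists c, forall n, W n <-> exists y, run C c n y.

(* Bijection between binary strings and numbers (bijective base 2). *)
Fixpoint str_code (s : seq bool) : nat :=
  if s is b :: s' then (str_code s').*2 + b.+1 else 0.

Definition machine := seq bool -> option (seq bool).

Definition partial_computable (M : machine) : Prop :=
  exists c, forall t s,
    M t = Some s <-> run (fun=> false) c (str_code t) (str_code s).

Definition prefix_free (M : machine) : Prop :=
  forall t t', M t -> M t' -> prefix t t' -> t = t'.

(* Optimality up to an additive constant: K is only defined up to the choice
   of such a machine. *)
Definition universal_prefix_free (U : machine) : Prop :=
  [/\ partial_computable U, prefix_free U &
      forall M, partial_computable M -> prefix_free M ->
        exists d, forall t s, M t = Some s ->
          exists2 t', U t' = Some s & size t' <= size t + d].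

(* The length of a shortest U-description of s; the default value 0 is never
   reached when U is universal, since then every string has a description. *)
Definition K (U : machine) (s : seq bool) : nat :=
  xget 0 [set k | (exists2 t, U t = Some s & size t = k) /\
                  (forall t, U t = Some s -> k <= size t)].

Definition restr (X : nat -> bool) (n : nat) : seq bool := mkseq X n.

Definition principal_function (S : set nat) (p : nat -> nat) : Prop :=
  {homo p : m n / m < n} /\ range p = S.

Definition hatPi01 (C : nat -> bool) : set (set nat) :=
  [set S | [/\ infinite_set S, ce_in C (~` S) &
     exists p f, [/\ principal_function S p, computable_in C f &
                     forall n, p n <= f n]]].

(* At n = 0 the quotient is 0 by the convention x / 0 = 0. This does not
   affect the supremum, as [hatPi01 C] is closed under removing 0 from N. *)
Definition dim_si_hatPi01 (R : realType) (U : machine)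
    (C X : nat -> bool) : \bar R :=
  ereal_sup [set ereal_inf [set ((K U (restr X n))%:R / n%:R)%R%:E | n in N]
            | N in hatPi01 C].

(* Main.v *)
(* Cut the positive numbers into blocks [Q^c, Q^(c+1)), where Q = q^2 and
   q = 16, and call a block special when c is the code of an initial segment of
   A. Let X be incompressible on [Q^c, q Q^c) for every special block and 0
   elsewhere. The set N of the numbers q Q^c with c special is A-computable, and
   K(X|n) >= (15/16) n on N by counting. If n is large and its block is not
   special, then X is 0 on [n/q, n), hence K(X|n) <= n/2. So if
   dim_B X > 1/2, then some S in hatPi01(B) has all its large elements in
   special blocks. Each large element of S thus reveals an initial segment of A,
   and as S is co-c.e. in B with a B-computable bound on its elements, both A
   and its complement are c.e. in B. *)

From Stdlib Require Import Cantor.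
Require Import Defs.
From mathcomp Require Import all_boot all_order all_algebra.
From mathcomp Require Import all_classical all_reals all_analysis.
From mathcomp Require Import zify.

Set Implicit Arguments.
Unset Strict Implicit.
Unset Printing Implicit Defensive.

Import Order.TTheory GRing.Theory Num.Theory.

(** * Closure properties of computable functions *)

Lemma nfst_npair x y : nfst (npair x y) = x.
Proof. by rewrite /nfst /npair cancel_of_to. Qed.

Lemma nsnd_npair x y : nsnd (npair x y) = y.
Proof. by rewrite /nsnd /npair cancel_of_to. Qed.

Definition npairE := (nfst_npair, nsnd_npair).

Lemma npair_fst_snd z : npair (nfst z) (nsnd z) = z.
Proof. by rewrite /npair /nfst /nsnd -surjective_pairing cancel_to_of. Qed.

Definition run_rec (C : nat -> bool) (f g : oprog) (x : nat) :=
  fix rec (n z : nat) {struct n} : Prop :=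
    match n with
    | 0 => run C f x z
    | m.+1 => exists2 u, rec m u & run C g (npair x (npair m u)) z
    end.

Lemma run_CRec C f g x y :
  run C (CRec f g) x y = run_rec C f g (nfst x) (nsnd x) y.
Proof. by []. Qed.

Lemma run_functional C c x y y' : run C c x y -> run C c x y' -> y = y'.
Proof.
elim: c x y y' => [|||||f IHf g IHg|f IHf g IHg|f IHf g IHg|f IHf] x y y' //=;
  try by move=> -> ->.
- move=> [u [v [fu gv ->]]] [u' [v' [fu' gv' ->]]].
  by rewrite (IHf _ _ _ fu fu') (IHg _ _ _ gv gv').
- move=> [u gu fy] [u' gu' fy']; rewrite -(IHg _ _ _ gu gu') in fy'.
  exact: IHf fy fy'.
- rewrite -!/(run_rec C f g _ _ _).
  elim: (nsnd x) y y' => [|m IHm] y y' /=; first exact: IHf.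
  move=> [u ru gy] [u' ru' gy']; rewrite -(IHm _ _ ru ru') in gy'.
  exact: IHg gy gy'.
- move=> [fy0 fy] [fy0' fy']; case: (ltngtP y y') => // lt_yy'.
  + by have [u fu] := fy' _ lt_yy'; have := IHf _ _ _ fy0 fu.
  + by have [u fu] := fy _ lt_yy'; have := IHf _ _ _ fy0' fu.
Qed.

Implicit Type C : nat -> bool.

Lemma eq_computable C f g : f =1 g -> computable_in C f -> computable_in C g.
Proof. by move=> fg [c cP]; exists c => n; rewrite -fg. Qed.

Lemma computable_comp {C} f g :
  computable_in C f -> computable_in C g -> computable_in C (fun x => f (g x)).
Proof. by move=> [c cP] [d dP]; exists (CComp c d) => n /=; exists (g n). Qed.

Lemma computable_pair C f g : computable_in C f -> computable_in C g ->
  computable_in C (fun x => npair (f x) (g x)).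
Proof.
by move=> [c cP] [d dP]; exists (CPair c d) => n /=; exists (f n), (g n).
Qed.

Lemma computable_fst C f :
  computable_in C f -> computable_in C (fun x => nfst (f x)).
Proof. by apply: computable_comp; exists CFst. Qed.

Lemma computable_snd C f :
  computable_in C f -> computable_in C (fun x => nsnd (f x)).
Proof. by apply: computable_comp; exists CSnd. Qed.

Lemma computable_succ C f :
  computable_in C f -> computable_in C (fun x => (f x).+1).
Proof. by apply: (@computable_comp _ succn); exists CSucc. Qed.

Lemma computable_oracle C f :
  computable_in C f -> computable_in C (fun x => nat_of_bool (C (f x))).
Proof.
by apply: (@computable_comp _ (fun x => nat_of_bool (C x))); exists COracle.
Qed.

Lemma computable_id {C} : computable_in C (fun x => x).
Proof.
apply: (@eq_computable _ (fun x => npair (nfst x) (nsnd x))).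
  exact: npair_fst_snd.
by apply: computable_pair; [exists CFst | exists CSnd].
Qed.

Lemma computable_const {C} n : computable_in C (fun=> n).
Proof.
by elim: n => [|n IHn]; [exists CZero | apply: computable_succ].
Qed.

Create HintDb computable.
#[local] Hint Resolve computable_id computable_const computable_pair
  computable_fst computable_snd computable_succ computable_oracle : computable.

Ltac computability := eauto 30 with computable.

Lemma computable_iteri C (b f : nat -> nat) (g : nat -> nat -> nat -> nat) :
    computable_in C b -> computable_in C f ->
    computable_in C
      (fun w => g (nfst w) (nfst (nsnd w)) (nsnd (nsnd w))) ->
  computable_in C (fun x => iteri (b x) (g x) (f x)).
Proof.
move=> cb [c cP] [d dP].
pose h w := iteri (nsnd w) (g (nfst w)) (f (nfst w)).
apply: (@eq_computable _ (fun x => h (npair x (b x)))).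
  by move=> x /=; rewrite /h !npairE.
apply: (@computable_comp _ h); last exact: computable_pair computable_id cb.
exists (CRec c d) => w; rewrite run_CRec /h.
elim: (nsnd w) => [|m IHm] /=; first exact: cP.
eexists; first exact: IHm.
by have := dP (npair (nfst w) (npair m (iteri m (g (nfst w)) (f (nfst w)))));
  rewrite !npairE.
Qed.

Lemma computable_iter C (b f : nat -> nat) (g : nat -> nat) :
    computable_in C b -> computable_in C f -> computable_in C g ->
  computable_in C (fun x => iter (b x) g (f x)).
Proof.
move=> cb cf cg.
apply: (@eq_computable _ (fun x => iteri (b x) (fun=> g) (f x))).
  by move=> x; elim: (b x) => //= n ->.
apply: computable_iteri => //.
by apply: (computable_comp cg); computability.
Qed.

Lemma computable_mu C (g : nat -> nat -> nat) h :
    computable_in C (fun w => g (nfst w) (nsnd w)) ->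
    (forall x, g x (h x) = 0) -> (forall x y, y < h x -> 0 < g x y) ->
  computable_in C h.
Proof.
move=> [c cP] gh0 gh; exists (CMu c) => x /=; split.
  by have := cP (npair x (h x)); rewrite !npairE gh0.
move=> z zh; exists (g x z).-1.
by rewrite prednK ?gh//; have := cP (npair x z); rewrite !npairE.
Qed.

Lemma computable_add C f g : computable_in C f -> computable_in C g ->
  computable_in C (fun x => f x + g x).
Proof.
move=> cf cg; apply: (@eq_computable _ (fun x => iter (f x) succn (g x))).
  by move=> x; elim: (f x) => //= n ->.
by apply: computable_iter => //; exact: computable_succ computable_id.
Qed.

Lemma computable_pred C f :
  computable_in C f -> computable_in C (fun x => (f x).-1).
Proof.
move=> cf; apply: (@eq_computable _ (fun x => iteri (f x) (fun m _ => m) 0)).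
  by move=> x; case: (f x).
apply: computable_iteri => //; first exact: computable_const.
exact: computable_fst (computable_snd computable_id).
Qed.

Lemma computable_sub C f g : computable_in C f -> computable_in C g ->
  computable_in C (fun x => f x - g x).
Proof.
move=> cf cg; apply: (@eq_computable _ (fun x => iter (g x) predn (f x))).
  by move=> x; elim: (g x) => [|n IHn]; rewrite ?subn0 // iterS IHn subnS.
by apply: computable_iter => //; exact: computable_pred computable_id.
Qed.

Lemma computable_mul C f g : computable_in C f -> computable_in C g ->
  computable_in C (fun x => f x * g x).
Proof.
move=> cf cg.
apply: (@eq_computable _ (fun x => iteri (f x) (fun _ u => g x + u) 0)).
  by move=> x; elim: (f x) => //= n ->.
apply: (@computable_iteri _ f (fun=> 0) (fun x _ u => g x + u)) => //.
  exact: computable_const.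
apply: computable_add; last computability.
by apply: (computable_comp cg); exact: computable_fst computable_id.
Qed.

Lemma computable_exp C f g : computable_in C f -> computable_in C g ->
  computable_in C (fun x => f x ^ g x).
Proof.
move=> cf cg.
apply: (@eq_computable _ (fun x => iteri (g x) (fun _ u => f x * u) 1)).
  by move=> x; elim: (g x) => //= n ->; rewrite expnS.
apply: (@computable_iteri _ g (fun=> 1) (fun x _ u => f x * u)) => //.
  exact: computable_const.
apply: computable_mul; last computability.
by apply: (computable_comp cf); exact: computable_fst computable_id.
Qed.

Lemma computable_negb C (p : nat -> bool) :
  computable_in C (fun x => nat_of_bool (p x)) ->
  computable_in C (fun x => nat_of_bool (~~ p x)).
Proof.
move=> cp; apply: (@eq_computable _ (fun x => 1 - p x)).
  by move=> x; case: (p x).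
exact: computable_sub (computable_const 1) cp.
Qed.

Lemma computable_andb C (p q : nat -> bool) :
  computable_in C (fun x => nat_of_bool (p x)) ->
  computable_in C (fun x => nat_of_bool (q x)) ->
  computable_in C (fun x => nat_of_bool (p x && q x)).
Proof.
move=> cp cq; apply: (@eq_computable _ (fun x => p x * q x)).
  by move=> x; rewrite mulnb.
exact: computable_mul.
Qed.

Lemma computable_leq C f g : computable_in C f -> computable_in C g ->
  computable_in C (fun x => nat_of_bool (f x <= g x)).
Proof.
move=> cf cg; apply: (@eq_computable _ (fun x => 1 - (f x - g x))).
  by move=> x; rewrite /leq; case: (f x - g x).
by apply: computable_sub (computable_const 1) _; exact: computable_sub.
Qed.

Lemma computable_eq C f g : computable_in C f -> computable_in C g ->
  computable_in C (fun x => nat_of_bool (f x == g x)).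
Proof.
move=> cf cg.
apply: (@eq_computable _ (fun x => nat_of_bool ((f x <= g x) && (g x <= f x)))).
  by move=> x; rewrite -eqn_leq.
by apply: computable_andb; exact: computable_leq.
Qed.

Lemma computable_if C (p : nat -> bool) f g :
    computable_in C (fun x => nat_of_bool (p x)) ->
    computable_in C f -> computable_in C g ->
  computable_in C (fun x => if p x then f x else g x).
Proof.
move=> cp cf cg; apply: (@eq_computable _ (fun x => p x * f x + ~~ p x * g x)).
  by move=> x; case: (p x); rewrite /= !(mul1n, mul0n, addn0).
by apply: computable_add; apply: computable_mul => //; exact: computable_negb.
Qed.

Lemma computable_sum C (b : nat -> nat) (g : nat -> nat -> nat) :
    computable_in C b -> computable_in C (fun w => g (nfst w) (nsnd w)) ->
  computable_in C (fun x => \sum_(i < b x) g x i).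
Proof.
move=> cb cg.
apply: (@eq_computable _ (fun x => iteri (b x) (fun i u => u + g x i) 0)).
  move=> x; elim: (b x) => [|n IHn]; first by rewrite big_ord0.
  by rewrite big_ord_recr /= IHn.
apply: (@computable_iteri _ b (fun=> 0) (fun x i u => u + g x i)) => //.
  exact: computable_const.
apply: computable_add; first computability.
pose h v := g (nfst v) (nsnd v).
apply: (@eq_computable _ (fun w => h (npair (nfst w) (nfst (nsnd w))))).
  by move=> w; rewrite /h !npairE.
apply: (@computable_comp _ h) => //; computability.
Qed.

#[local] Hint Resolve computable_pred computable_add computable_sub
  computable_mul computable_exp computable_negb computable_andb computable_leq
  computable_eq computable_if : computable.

Lemma computable_half C f :
  computable_in C f -> computable_in C (fun x => (f x)./2).
Proof.
move=> cf; apply: (@eq_computable _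
  (fun x => iteri (f x) (fun i u => i - u) 0)).
  by move=> x; elim: (f x) => //= n ->; rewrite uphalfE; lia.
by apply: computable_iteri; computability.
Qed.

Lemma computable_odd C f :
  computable_in C f -> computable_in C (fun x => nat_of_bool (odd (f x))).
Proof.
move=> cf; apply: (@eq_computable _ (fun x => f x - (f x)./2 - (f x)./2)).
  by move=> x; lia.
by have := computable_half cf; computability.
Qed.

Lemma computable_trunc_log C p f :
  computable_in C f -> computable_in C (fun x => trunc_log p (f x)).
Proof.
apply: computable_comp.
have [p1|p1] := leqP p 1.
  apply: (@eq_computable _ (fun=> 0)); last computability.
  by move: p p1 => [|[|]].
apply: (@computable_mu _ (fun x y => (p ^ y.+1 <= x : bool) : nat)).
- computability.
- move=> x /=; apply/eqP; rewrite eqb0 -ltnNge.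
  exact: trunc_log_ltn.
- move=> x y yx; rewrite lt0b (leq_trans (leq_pexp2l _ yx)) ?(ltnW p1)//.
  apply: trunc_logP => //; case: x yx => //.
  by rewrite trunc_log0.
Qed.
#[local] Hint Resolve computable_half computable_odd computable_trunc_log
  : computable.

(** * Change of oracle and step-bounded evaluation *)

Lemma computable_comp2 C (h : nat -> nat -> nat) f g :
    computable_in C (fun w => h (nfst w) (nsnd w)) ->
    computable_in C f -> computable_in C g ->
  computable_in C (fun x => h (f x) (g x)).
Proof.
move=> ch cf cg; pose k w := h (nfst w) (nsnd w).
apply: (@eq_computable _ (fun x => k (npair (f x) (g x)))).
  by move=> x; rewrite /k !npairE.
by apply: (@computable_comp _ k) => //; computability.
Qed.

Fixpoint subst_oracle (a c : oprog) : oprog :=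
  match c with
  | COracle => a
  | CPair f g => CPair (subst_oracle a f) (subst_oracle a g)
  | CComp f g => CComp (subst_oracle a f) (subst_oracle a g)
  | CRec f g => CRec (subst_oracle a f) (subst_oracle a g)
  | CMu f => CMu (subst_oracle a f)
  | c => c
  end.

Lemma run_subst_oracle (A B : nat -> bool) a :
    (forall n, run B a n (A n)) ->
  forall c x y, run B (subst_oracle a c) x y <-> run A c x y.
Proof.
move=> aP; elim=> [|||||f IHf g IHg|f IHf g IHg|f IHf g IHg|f IHf] x y //.
- by split=> [ay|/= ->]; [apply: run_functional ay (aP x)|].
- by split=> -[u [v [/IHf fu /IHg gv ->]]]; exists u, v.
- by split=> -[u /IHg gu /IHf fy]; exists u.
- rewrite !run_CRec; elim: (nsnd x) y => [|m IHm] y; first exact: IHf.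
  by split=> -[u /IHm ru /IHg gy]; exists u.
- split=> -[/IHf fy0 fy]; split=> // z /fy[u /IHf fu]; by exists u.
Qed.

Lemma computable_in_trans A B f :
  Turing_le A B -> computable_in A f -> computable_in B f.
Proof.
move=> [a aP] [c cP]; exists (subst_oracle a c) => n.
exact/run_subst_oracle.
Qed.

Lemma ce_in_trans A B W : Turing_le A B -> ce_in A W -> ce_in B W.
Proof.
move=> [a aP] [c cP]; exists (subst_oracle a c) => n; rewrite cP.
by split=> -[y cy]; exists y; apply/(run_subst_oracle aP).
Qed.

Lemma hatPi01_subset A B : Turing_le A B -> (hatPi01 A `<=` hatPi01 B)%classic.
Proof.
move=> AB S [Sinf ceS [p [f [pS cf pf]]]]; split=> //.
  exact: ce_in_trans ceS.
by exists p, f; split=> //; exact: computable_in_trans cf.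
Qed.

(* [e x s] is the outcome of running the program for [s] steps on [x]: [0]
   when it has not halted yet, [y.+1] when it has halted with output [y]. *)
Definition evaluator C (c : oprog) (e : nat -> nat -> nat) : Prop :=
  [/\ computable_in C (fun w => e (nfst w) (nsnd w)),
      forall x s s' y, s <= s' -> e x s = y.+1 -> e x s' = y.+1 &
      forall x y, run C c x y <-> exists s, e x s = y.+1].

Lemma evaluator_total C c h :
  computable_in C h -> (forall x y, run C c x y <-> y = h x) ->
  evaluator C c (fun x _ => (h x).+1).
Proof.
move=> ch cP; split=> //; first by apply: computable_succ;
  apply: (computable_comp ch); computability.
by move=> x y; rewrite cP; split=> [->|[_ [->]]]; [exists 0|].
Qed.

Lemma evaluator_pair C f g ef eg : evaluator C f ef -> evaluator C g eg ->
  evaluator C (CPair f g) (fun x s =>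
    if (0 < ef x s) && (0 < eg x s)
    then (npair (ef x s).-1 (eg x s).-1).+1 else 0).
Proof.
move=> [cf mf fP] [cg mg gP]; split; first computability.
  move=> x s s' y ss'; case Ef: (ef x s) => [|u] //.
  case Eg: (eg x s) => [|v] //= [<-].
  by rewrite (mf _ _ _ _ ss' Ef) (mg _ _ _ _ ss' Eg).
move=> x y; split=> /=.
  move=> [u [v [/fP[s es] /gP[t et] ->]]]; exists (maxn s t).
  by rewrite (mf _ _ _ _ (leq_maxl s t) es) (mg _ _ _ _ (leq_maxr s t) et).
move=> [s]; case Ef: (ef x s) => [|u] //; case Eg: (eg x s) => [|v] //= [<-].
by exists u, v; split=> //; [apply/fP; exists s | apply/gP; exists s].
Qed.

Lemma evaluator_comp C f g ef eg : evaluator C f ef -> evaluator C g eg ->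
  evaluator C (CComp f g) (fun x s =>
    if 0 < eg x s then ef (eg x s).-1 s else 0).
Proof.
move=> [cf mf fP] [cg mg gP]; split.
  by apply: computable_if; [| apply: computable_comp2 |]; computability.
  move=> x s s' y ss'; case Eg: (eg x s) => [|v] //= Ef.
  by rewrite (mg _ _ _ _ ss' Eg) /= (mf _ _ _ _ ss' Ef).
move=> x y; split=> /=.
  move=> [u /gP[s es] /fP[t et]]; exists (maxn s t).
  by rewrite (mg _ _ _ _ (leq_maxl s t) es) /= (mf _ _ _ _ (leq_maxr s t) et).
move=> [s]; case Eg: (eg x s) => [|v] //= Ef.
by exists v; [apply/gP; exists s | apply/fP; exists s].
Qed.

Lemma evaluator_rec C f g ef eg : evaluator C f ef -> evaluator C g eg ->
  evaluator C (CRec f g) (fun x s =>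
    iteri (nsnd x)
      (fun m u => if 0 < u then eg (npair (nfst x) (npair m u.-1)) s else 0)
      (ef (nfst x) s)).
Proof.
move=> [cf mf fP] [cg mg gP].
pose E x s n := iteri n
  (fun m u => if 0 < u then eg (npair x (npair m u.-1)) s else 0) (ef x s).
have ES x s n : E x s n.+1 =
  if 0 < E x s n then eg (npair x (npair n (E x s n).-1)) s else 0 by [].
have mE x s s' n y : s <= s' -> E x s n = y.+1 -> E x s' n = y.+1.
  move=> ss'; elim: n y => [|n IHn] y; first exact: mf.
  rewrite !ES; case En: (E x s n) => [|u] //= Eg.
  by rewrite (IHn _ En) /= (mg _ _ _ _ ss' Eg).
split=> [|x s s' y|x y].
- apply: (@computable_iteri _ _ _ (fun w m u => if 0 < u then
    eg (npair (nfst (nfst w)) (npair m u.-1)) (nsnd w) else 0)).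
  + computability.
  + by apply: computable_comp2; computability.
  + by apply: computable_if; [| apply: computable_comp2 |]; computability.
- exact: mE.
- rewrite run_CRec -/(E _ _ _); elim: (nsnd x) y => [|m IHm] y; first exact: fP.
  split=> /=.
    move=> [u /IHm[s es] /gP[t et]]; exists (maxn s t).
    rewrite -/(E _ _ m).
    by rewrite (mE _ _ _ _ _ (leq_maxl s t) es) /=
      (mg _ _ _ _ (leq_maxr s t) et).
  move=> [s]; rewrite -/(E _ _ m); case Em: (E _ _ m) => [|u] //= Eg.
  by exists u; [apply/IHm; exists s | apply/gP; exists s].
Qed.

(* The state of the unbounded search is [0] while every value examined so far
   was positive, [1] once some value was not available, and [z.+2] once the
   zero [z] was found. *)
Lemma evaluator_mu C f ef : evaluator C f ef ->
  evaluator C (CMu f) (fun x s =>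
    (iteri s (fun z st => if st == 0 then
       if ef (npair x z) s == 0 then 1
       else if ef (npair x z) s == 1 then z.+2 else 0 else st) 0).-1).
Proof.
move=> [cf mf fP].
pose E x s n := iteri n (fun z st => if st == 0 then
       if ef (npair x z) s == 0 then 1
       else if ef (npair x z) s == 1 then z.+2 else 0 else st) 0.
have ES x s n : E x s n.+1 = if E x s n == 0 then
    if ef (npair x n) s == 0 then 1
    else if ef (npair x n) s == 1 then n.+2 else 0 else E x s n by [].
have E0 x s n : E x s n = 0 <-> forall z, z < n -> 1 < ef (npair x z) s.
  elim: n => [|n IHn]; first by [].
  rewrite ES; split.
    case: (E x s n =P 0) => // /IHn lt_n; case Ef: (ef _ s) => [|[|u]] //= _ z.
    by rewrite ltnS leq_eqVlt => /predU1P[->|/lt_n //]; rewrite Ef.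
  move=> lt_n; have -> : E x s n = 0 by apply/IHn => z /ltnW/lt_n.
  by case: (ef _ s) (lt_n n (ltnSn n)) => [|[|]].
have E2 x s n y : E x s n = y.+2 <->
    [/\ y < n, ef (npair x y) s = 1 & forall z, z < y -> 1 < ef (npair x z) s].
  elim: n y => [|n IHn] y; first by split=> // -[].
  rewrite ES; case: (E x s n =P 0) => [En|En]; last first.
    rewrite IHn; split=> [[yn ? ?]|[]]; first by split=> //; exact: ltnW.
    rewrite ltnS leq_eqVlt => /predU1P[->|//] _ /E0 //.
  split.
    case Ef: (ef _ s) => [|[|u]] //= -[<-]; split=> //.
    exact/E0.
  move=> [yn Ef lt_y]; move: yn; rewrite ltnS leq_eqVlt => /predU1P[<-|yn].
    by rewrite Ef.
  by move/E0: En => /(_ _ yn); rewrite Ef.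
have mE x s s' y : s <= s' -> E x s s = y.+2 -> E x s' s' = y.+2.
  move=> ss' /E2[ys Ef lt_y]; apply/E2; split; first exact: leq_trans ss'.
    exact: mf Ef.
  move=> z /lt_y; case Ez: (ef _ s) => [|u] //.
  by rewrite (mf _ _ _ _ ss' Ez).
have pE n y : (n.-1 == y.+1) = (n == y.+2) by case: n.
split=> [|x s s' y|x y].
- apply: computable_pred; apply: (@computable_iteri _ _ _
    (fun w z st => if st == 0 then
       if ef (npair (nfst w) z) (nsnd w) == 0 then 1
       else if ef (npair (nfst w) z) (nsnd w) == 1 then z.+2 else 0 else st)).
  + computability.
  + computability.
  + have ce : computable_in C (fun w : nat => ef
       (npair (nfst (nfst w)) (nfst (nsnd w))) (nsnd (nfst w))).
      by apply: computable_comp2; computability.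
    computability.
- move=> ss' /eqP; rewrite -/(E x s s) pE => /eqP /(mE _ _ _ _ ss').
  by rewrite -/(E x s' s') => ->.
- split=> /=.
    move=> [/fP[s0 es0] lt_y].
    have /choice[u uP] : forall z, exists s,
        z < y -> forall s', s <= s' -> 1 < ef (npair x z) s'.
      move=> z; case: (ltnP z y) => [zy|]; last by exists 0.
      have [u /fP[s es]] := lt_y _ zy; exists s => _ s' ss'.
      by rewrite (mf _ _ _ _ ss' es).
    pose t := y.+1 + s0 + \sum_(z < y) u z; exists t.
    apply/eqP; rewrite -/(E x t t) pE; apply/eqP/E2; split.
    + by rewrite /t -addnA leq_addr.
    + by apply: mf es0; rewrite /t addnAC leq_addl.
    + move=> z zy; apply: (uP z zy); rewrite /t (bigD1 (Ordinal zy)) //=; lia.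
  move=> [s /eqP]; rewrite -/(E x s s) pE => /eqP /E2[ys Ef lt_y]; split.
    by apply/fP; exists s.
  move=> z /lt_y; case Ez: (ef _ s) => [|[|u]] // _.
  by exists u; apply/fP; exists s.
Qed.

Lemma evaluator_exists C c : exists e, evaluator C c e.
Proof.
elim: c => [|||||f [ef Ef] g [eg Eg]|f [ef Ef] g [eg Eg]|f [ef Ef] g [eg Eg]
           |f [ef Ef]].
- by eexists; apply: (@evaluator_total _ _ (fun=> 0)); computability.
- by eexists; apply: (@evaluator_total _ _ succn); computability.
- by eexists; apply: (@evaluator_total _ _ nfst); computability.
- by eexists; apply: (@evaluator_total _ _ nsnd); computability.
- by eexists; apply: (@evaluator_total _ _ (fun x => nat_of_bool (C x)));
    computability.
- by eexists; exact: evaluator_pair Ef Eg.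
- by eexists; exact: evaluator_comp Ef Eg.
- by eexists; exact: evaluator_rec Ef Eg.
- by eexists; exact: evaluator_mu Ef.
Qed.

Lemma ce_in_stages C W : ce_in C W -> exists w : nat -> nat -> bool,
  [/\ computable_in C (fun z => nat_of_bool (w (nfst z) (nsnd z))),
      forall n s s', s <= s' -> w n s -> w n s' &
      forall n, W n <-> exists s, w n s].
Proof.
move=> [c cP]; have [e [ce me eP]] := evaluator_exists C c.
exists (fun n s => 0 < e n s); split; first computability.
  move=> n s s' ss'; case E: (e n s) => [|y] // _.
  by rewrite (me _ _ _ _ ss' E).
move=> n; rewrite cP; split.
  by move=> [y /eP[s es]]; exists s; rewrite es.
by move=> [s]; case E: (e n s) => [|y] // _; exists y; apply/eP; exists s.
Qed.

Lemma homo_ltn_id_leq (p : nat -> nat) n : {homo p : m n / m < n} -> n <= p n.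
Proof. by move=> ltp; elim: n => // n /leq_ltn_trans; apply; exact: ltp. Qed.

Lemma ce_in_compl_range C p : computable_in C p -> {homo p : m n / m < n} ->
  ce_in C (~` range p)%classic.
Proof.
move=> cp ltp.
pose g n := \sum_(j < n.+1) (p j == n).
have cg : computable_in C g.
  apply: (@computable_sum _ _ (fun n j => p j == n)); first computability.
  have cpj : computable_in C (fun w => p (nsnd w)).
    by apply: (computable_comp cp); computability.
  computability.
have [c cP] : computable_in C (fun w => g (nfst w)).
  by apply: (computable_comp cg); computability.
have g0 n : (~` range p)%classic n <-> g n = 0.
  split=> [np|/eqP].
    apply/eqP; rewrite sum_nat_eq0; apply/forallP => j; apply/implyP => _.
    by rewrite eqb0; apply: contra_notN np => /eqP <-; exists j.
  rewrite sum_nat_eq0 => /forallP gn [j _ pj].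
  have jn : j < n.+1 by rewrite ltnS -pj; exact: homo_ltn_id_leq.
  by have := gn (Ordinal jn); rewrite /= pj eqxx.
exists (CMu c) => n; rewrite g0; split=> [gn|[y [cy _]]].
  by exists 0; split=> //; have := cP (npair n 0); rewrite npairE gn.
by have := cP (npair n y); rewrite npairE => /run_functional/(_ cy).
Qed.

(** * Reading an oracle off the blocks *)

Lemma str_code_cat s t :
  str_code (s ++ t) = str_code s + 2 ^ size s * str_code t.
Proof.
elim: s => [|b s IHs] /=; first by rewrite expn0 mul1n.
by rewrite IHs expnS; lia.
Qed.

Lemma str_code_bounds s : 2 ^ size s <= (str_code s).+1 < 2 ^ (size s).+1.
Proof. by elim: s => // b s; rewrite /= !expnS; lia. Qed.

Lemma str_code_inj : injective str_code.
Proof.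
elim=> [|b s IHs] [|b' s'] //=; try lia.
move=> E; have Eb : b = b' by move: E; case: b b' => -[] //; lia.
by rewrite Eb (IHs s') //; lia.
Qed.

Lemma str_code_surj z : exists s, str_code s = z.
Proof.
elim/ltn_ind: z => -[|z] IHz; first by exists [::].
have [|s sz] := IHz z./2; first lia.
by exists (odd z :: s); rewrite /= sz; lia.
Qed.

Lemma str_code_behead s : (str_code s).-1./2 = str_code (behead s).
Proof. by case: s => [|b s] //=; lia. Qed.

Lemma str_code_drop s i :
  iter i (fun c => c.-1./2) (str_code s) = str_code (drop i s).
Proof.
elim: i => [|i IHi] /=; first by rewrite drop0.
by rewrite IHi str_code_behead -drop1 drop_drop.
Qed.

Lemma odd_str_code b s : odd (str_code (b :: s)) = ~~ b.
Proof. by rewrite /=; lia. Qed.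

Lemma size_restr X n : size (restr X n) = n.
Proof. exact: size_mkseq. Qed.

Definition block_bit Q n i :=
  ~~ odd (iter i (fun c => c.-1./2) (trunc_log Q n)).

Lemma block_bitE Q (A : nat -> bool) n i k : 1 < Q -> Q ^ 2 ^ i.+1 <= n ->
  trunc_log Q n = str_code (restr A k) -> block_bit Q n i = A i.
Proof.
move=> Q1 le_n En; have lt_ik : i < k.
  have := str_code_bounds (restr A k); rewrite size_restr -En => /andP[_].
  have : 2 ^ i.+1 <= trunc_log Q n by apply: trunc_log_max.
  move=> /leq_ltn_trans lt_i /ltnW/lt_i; rewrite ltn_exp2l //.
rewrite /block_bit En str_code_drop (drop_nth false) ?size_restr//.
by rewrite odd_str_code nth_mkseq// negbK.
Qed.

(* The block of [p (n0 + Q ^ 2 ^ i.+1)] codes a string longer than [i], so bit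
   [i] of [A] is the only [b] for which the stages of the complement of [S]
   never exhaust the numbers below the bound whose block has bit [i] equal
   to [b]. *)
Lemma Turing_le_of_blocks Q A B S n0 : 1 < Q -> hatPi01 B S ->
    (forall n, S n -> n0 <= n ->
       exists k, trunc_log Q n = str_code (restr A k)) ->
  Turing_le A B.
Proof.
move=> Q1 [_ ceS [p [f [[ltp pS] cf pf]]]] SA.
have [w [cw mw wP]] := ce_in_stages ceS.
pose k i := n0 + Q ^ 2 ^ i.+1.
pose cnt (b : bool) i s := \sum_(n < (f (k i)).+1)
  [&& k i <= n, ~~ w n s & block_bit Q n i == b].
have bitA n i : S n -> k i <= n -> block_bit Q n i = A i.
  move=> Sn kin; have [j En] := SA n Sn (leq_trans (leq_addr _ _) kin).
  exact: block_bitE Q1 (leq_trans (leq_addl _ _) kin) En.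
have cnt_gt0 i s : 0 < cnt (A i) i s.
  have Sp : S (p (k i)) by rewrite -pS; exists (k i).
  have ltpf : p (k i) < (f (k i)).+1 by rewrite ltnS.
  have kp : k i <= p (k i) by exact: homo_ltn_id_leq.
  rewrite /cnt (bigD1 (Ordinal ltpf)) //= bitA// kp eqxx andbT /=.
  rewrite (_ : w (p (k i)) s = false) //; apply/negP => wp.
  by have /wP : exists s, w (p (k i)) s by exists s.
have cnt_eq0 i : exists s, cnt (~~ A i) i s = 0.
  have /choice[u uP] n : exists s, k i <= n -> block_bit Q n i == ~~ A i ->
      forall s', s <= s' -> w n s'.
    case: (leqP (k i) n) => [kin|]; last by exists 0.
    case: (eqVneq (block_bit Q n i) (~~ A i)) => [bn|]; last by exists 0.
    have /wP[s ws] : (~` S)%classic n.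
      by move=> Sn; move: bn; rewrite bitA //; case: (A i).
    by exists s => _ _ s' ss'; exact: mw ws.
  exists (\sum_(n < (f (k i)).+1) u n); apply/eqP; rewrite sum_nat_eq0.
  apply/forallP => n; apply/implyP => _; rewrite eqb0; apply/negP.
  move=> /and3P[kin nw bn]; move/negP: nw; apply; apply: uP => //.
  by rewrite (bigD1 n) //= leq_addr.
have ck : computable_in B k by rewrite /k; computability.
have cfk : computable_in B (fun i => f (k i)) by exact: computable_comp cf ck.
have ccnt b : computable_in B (fun v => cnt b (nfst v) (nsnd v)).
  apply: (@computable_sum _ _ (fun v n => [&& k (nfst v) <= n,
    ~~ w n (nsnd v) & block_bit Q n (nfst v) == b])).
    by apply: computable_succ; apply: (computable_comp cfk); computability.
  apply: computable_andb; first apply: computable_leq; [|computability|].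
    by apply: (computable_comp ck); computability.
  apply: computable_andb; first apply: computable_negb.
    by apply: (@computable_comp2 _ w); computability.
  have ct : computable_in B (fun v => iter (nfst (nfst v)) (fun c => c.-1./2)
      (trunc_log Q (nsnd v))).
    by apply: computable_iter; computability.
  apply: (@eq_computable _ (fun v => nat_of_bool (nat_of_bool (odd
    (iter (nfst (nfst v)) (fun c => c.-1./2) (trunc_log Q (nsnd v))))
      == nat_of_bool (~~ b)))); last computability.
  by move=> v; rewrite /block_bit; case: odd b => -[].
have cnt_ex i : exists s, cnt true i s * cnt false i s == 0.
  have [s cs] := cnt_eq0 i; exists s; move: cs.
  by case: (A i) => /= ->; rewrite ?muln0.
pose h i := ex_minn (cnt_ex i).
have ch : computable_in B h.
  apply: (@computable_mu _ (fun i s => cnt true i s * cnt false i s)).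
  - by have := ccnt true; have := ccnt false; computability.
  - by move=> i; apply/eqP; rewrite /h; case: ex_minnP.
  - move=> i y; rewrite /h; case: ex_minnP => s _ min_s; rewrite ltnNge.
    by apply: contraR; rewrite lt0n negbK => /min_s.
apply: (@eq_computable _ (fun i => nat_of_bool (0 < cnt true i (h i)))).
  move=> i; congr nat_of_bool; have := cnt_gt0 i (h i).
  have : cnt true i (h i) * cnt false i (h i) == 0.
    by rewrite /h; case: ex_minnP.
  case: (A i) => //= + c0; rewrite muln_eq0 (gtn_eqF c0) orbF => /eqP ->.
  by [].
apply: computable_leq; first computability.
by apply: (@computable_comp2 _ (cnt true)); computability.
Qed.

(** * Complexity bounds *)

Definition selfdelim (w : seq bool) : seq bool :=
  nseq (size w) true ++ false :: w.

Lemma size_selfdelim w : size (selfdelim w) = (size w).*2.+1.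
Proof. by rewrite size_cat size_nseq /= addnS addnn. Qed.

Lemma index_selfdelim w t : index false (selfdelim w ++ t) = size w.
Proof.
rewrite /selfdelim -catA index_cat mem_nseq andbF size_nseq /=.
by rewrite addn0.
Qed.

Lemma drop_selfdelim w : drop (index false (selfdelim w)).+1 (selfdelim w) = w.
Proof.
rewrite -[X in index _ X]cats0 index_selfdelim /selfdelim.
by rewrite drop_cat size_nseq ltnNge leqnSn /= subSnn drop1.
Qed.

Lemma selfdelim_inj : injective selfdelim.
Proof. by move=> w w' E; rewrite -(drop_selfdelim w) E drop_selfdelim. Qed.

Lemma prefix_selfdelim w w' :
  prefix (selfdelim w) (selfdelim w') -> selfdelim w = selfdelim w'.
Proof.
move=> /prefixP[t E]; have Ew : size w' = size w.
  by rewrite -(index_selfdelim w t) -E -[X in index _ X]cats0 index_selfdelim.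
have := congr1 size E; rewrite size_cat !size_selfdelim Ew.
by case: t E => [|b t] /=; [rewrite cats0 | lia].
Qed.

Lemma size_trunc_log_str_code w : trunc_log 2 (str_code w).+1 = size w.
Proof. by apply: trunc_log_eq => //; exact: str_code_bounds. Qed.

Lemma str_code_nseq_true k : str_code (nseq k true) = (2 ^ k).*2 - 2.
Proof.
elim: k => //= k ->; have : 0 < 2 ^ k by rewrite expn_gt0.
by rewrite expnS; lia.
Qed.

Definition selfdelim_code z :=
  2 ^ trunc_log 2 z.+1 * 2 - 2 + 2 ^ trunc_log 2 z.+1 * (z + z + 1).

Lemma str_code_selfdelim w :
  str_code (selfdelim w) = selfdelim_code (str_code w).
Proof.
rewrite /selfdelim_code size_trunc_log_str_code str_code_cat size_nseq.
by rewrite str_code_nseq_true /= muln2 addnn.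
Qed.

Definition pad_code z := nfst z + 2 ^ nsnd z - 1.

Definition pad_machine : machine := fun t =>
  let w := drop (index false t).+1 t in
  if t == selfdelim w then
    Some (xget [::] [set s | str_code s = pad_code (str_code w)]%classic)
  else None.

Lemma pad_machineP t s : pad_machine t = Some s <->
  exists2 w, t = selfdelim w & str_code s = pad_code (str_code w).
Proof.
rewrite /pad_machine; split.
  case: eqP => // E [<-]; exists (drop (index false t).+1 t) => //.
  by apply: (@xgetPex _ [::] [set s | str_code s = _]%classic);
    exact: str_code_surj.
move=> [w -> Es]; rewrite drop_selfdelim eqxx; congr Some.
by apply: xget_unique => //= s' Es'; apply: str_code_inj; rewrite Es' Es.
Qed.

Lemma prefix_free_pad_machine : prefix_free pad_machine.
Proof.
move=> t t'; case E: (pad_machine t) => [s|] // _.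
case E': (pad_machine t') => [s'|] // _.
move/pad_machineP: E => [w -> _]; move/pad_machineP: E' => [w' -> _].
exact: prefix_selfdelim.
Qed.

Lemma partial_computable_pad_machine : partial_computable pad_machine.
Proof.
have [g gP] : computable_in (fun=> false) pad_code.
  by rewrite /pad_code; computability.
have [c cP] : computable_in (fun=> false)
    (fun v => nat_of_bool (nfst v != selfdelim_code (nsnd v))).
  by rewrite /selfdelim_code; computability.
exists (CComp g (CMu c)) => t s; rewrite pad_machineP; split.
  move=> [w -> ->]; exists (str_code w) => //=; split.
    have := cP (npair (str_code (selfdelim w)) (str_code w)).
    by rewrite !npairE str_code_selfdelim eqxx.
  move=> z; have [w' <-] := str_code_surj z => ltw; exists 0.
  have := cP (npair (str_code (selfdelim w)) (str_code w')).
  rewrite !npairE -str_code_selfdelim; case: eqP => // /str_code_inj.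
  by move=> /selfdelim_inj Ew; rewrite Ew ltnn in ltw.
move=> [z [cz _] gz]; have Es := run_functional gz (gP z).
have [w Ez] := str_code_surj z; exists w; last by rewrite Ez.
have := run_functional cz (cP (npair (str_code t) z)).
rewrite !npairE -Ez -str_code_selfdelim; case: eqP => // /str_code_inj.
by [].
Qed.

Lemma str_code_restr X n :
  str_code (restr X n) = (\sum_(i < n) X i * 2 ^ i) + 2 ^ n - 1.
Proof.
elim: n => [|n IHn]; first by rewrite big_ord0.
rewrite /restr mkseqS -cats1 str_code_cat -/(restr X n) IHn size_restr.
rewrite big_ord_recr expnS /=.
have : 0 < 2 ^ n by rewrite expn_gt0.
by case: (X n) => /=; lia.
Qed.

Lemma npair_ltn v n : npair v n < (v + n).+1 ^ 2.
Proof. by have := Cantor.to_nat_spec v n; rewrite /npair; nia. Qed.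

Lemma exists_description_restr U (hU : universal_prefix_free U) :
  exists d, forall (X : nat -> bool) n l,
    (forall i, i < n -> X i -> i < l) ->
  exists2 t, U t = Some (restr X n) &
    size t <= 4 * (l + (trunc_log 2 n).+1) + d.
Proof.
have [_ _ optU] := hU.
have [d dP] := optU _ partial_computable_pad_machine prefix_free_pad_machine.
exists d.+1 => X n l lX; pose v := \sum_(i < n) X i * 2 ^ i.
have [w Ew] := str_code_surj (npair v n).
have [|t Ut le_t] := dP (selfdelim w) (restr X n).
  apply/pad_machineP; exists w => //.
  by rewrite Ew /pad_code !npairE str_code_restr.
exists t => //; apply: leq_trans le_t _; rewrite size_selfdelim.
have lt_v : v < 2 ^ l.
  rewrite /v; elim: n l lX {Ew Ut v} => [|n IHn] l lX.
    by rewrite big_ord0 expn_gt0.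
  rewrite big_ord_recr /=; case Xn: (X n); last first.
    by rewrite mul0n addn0; apply: IHn => i ltin; apply: lX; exact: ltnW.
  have ltnl : n < l by apply: lX.
  have := IHn n (fun i ltin _ => ltin).
  have : 2 ^ n.+1 <= 2 ^ l by rewrite leq_exp2l.
  by rewrite expnS mul1n; move: (\sum_(i < n) _) => u; lia.
have lt_n : n < 2 ^ (trunc_log 2 n).+1 by exact: trunc_log_ltn.
set r := (trunc_log 2 n).+1 in lt_n *.
have le_vn : (v + n).+1 <= 2 ^ (l + r) by rewrite expnD; nia.
have : size w <= 2 * (l + r); last by lia.
have /andP[+ _] := str_code_bounds w; rewrite Ew => le_w.
rewrite -(@leq_exp2l 2) // mulnC expnM.
apply: leq_trans le_w (leq_trans (npair_ltn v n) _).
by rewrite leq_exp2r.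
Qed.

Lemma K_spec U (hU : universal_prefix_free U) s :
  (exists2 t, U t = Some s & size t = K U s) /\
  (forall t, U t = Some s -> K U s <= size t).
Proof.
pose D k := `[< exists2 t, U t = Some s & size t = k >].
have exD : exists k, D k.
  have [d dP] := exists_description_restr hU.
  have [|t Ut _] := dP (nth false s) (size s) (size s) => //.
  exists (size t); apply/asboolP; exists t => //.
  by rewrite Ut /restr mkseq_nth.
pose E := [set k | (exists2 t, U t = Some s & size t = k) /\
  (forall t, U t = Some s -> k <= size t)]%classic.
rewrite -[_ /\ _]/(E (xget 0 E)); apply: xgetPex.
case: (ex_minnP exD) => k /asboolP Dk min_k; exists k; split=> // t Ut.
by apply: min_k; apply/asboolP; exists t.
Qed.

Lemma exists_incompressible U (hU : universal_prefix_free U) s L :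
  exists t, size t = L /\ L <= K U (s ++ t).
Proof.
apply: contrapT => compr.
have /choice[d dP] : forall t : L.-tuple bool, exists d : seq bool,
    U d = Some (s ++ t) /\ size d < L.
  move=> t; have [[d Ud sd] _] := K_spec hU (s ++ t); exists d; split => //.
  rewrite sd ltnNge; apply/negP => leL; apply: compr.
  by exists t; rewrite size_tuple.
have lt_d t : str_code (d t) < 2 ^ L - 1.
  have [_ lt_dL] := dP t; have /andP[_] := str_code_bounds (d t).
  have : 2 ^ (size (d t)).+1 <= 2 ^ L by rewrite leq_exp2l.
  lia.
have : injective (fun t => Ordinal (lt_d t)).
  move=> t t' /(congr1 val) /= /str_code_inj Ed.
  have [Ut _] := dP t; have [Ut' _] := dP t'.
  move: Ut; rewrite Ed Ut' => -[] /eqP; rewrite eqseq_cat// eqxx /= => /eqP.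
  by move=> /val_inj.
move=> /leq_card; rewrite card_tuple card_bool card_ord.
have : 0 < 2 ^ L by rewrite expn_gt0.
lia.
Qed.

Definition block_top q c := q * (q ^ 2) ^ c.

Lemma exists_block_incompressible U (P : pred nat) q :
    universal_prefix_free U -> 1 < q ->
  exists X : nat -> bool,
    (forall c, P c ->
       q.-1 * (q ^ 2) ^ c <= K U (restr X (block_top q c))) /\
    (forall i, X i ->
       P (trunc_log (q ^ 2) i) /\ i < block_top q (trunc_log (q ^ 2) i)).
Proof.
move=> hU q1; set Q := q ^ 2; have Q1 : 1 < Q by rewrite /Q; nia.
have /choice[tau0 tau0P] : forall sL : seq bool * nat,
    exists t, size t = sL.2 /\ sL.2 <= K U (sL.1 ++ t).
  by move=> [s L]; exact: exists_incompressible.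
pose tau s L := tau0 (s, L).
have size_tau s L : size (tau s L) = L by have [] := tau0P (s, L).
have K_tau s L : L <= K U (s ++ tau s L) by have [] := tau0P (s, L).
pose rnd c s := if P c then tau s (q.-1 * Q ^ c) else nseq (q.-1 * Q ^ c) false.
pose Y := fix Y c := if c is c'.+1 then
    Y c' ++ rnd c' (Y c') ++ nseq (Q ^ c - q * Q ^ c') false
  else [:: false].
have YS c : Y c.+1 = Y c ++ rnd c (Y c) ++ nseq (Q ^ c.+1 - q * Q ^ c) false.
  by [].
have size_rnd c s : size (rnd c s) = q.-1 * Q ^ c.
  by rewrite /rnd; case: (P c); rewrite ?size_nseq.
have size_Y c : size (Y c) = Q ^ c.
  elim: c => // c IHc; rewrite YS !size_cat IHc size_rnd size_nseq.
  have : 0 < Q ^ c by rewrite expn_gt0 (ltnW Q1).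
  by rewrite expnS /Q; nia.
have leY c c' i : c <= c' -> i < Q ^ c ->
    nth false (Y c') i = nth false (Y c) i.
  elim: c' => [|c' IHc']; first by rewrite leqn0 => /eqP ->.
  rewrite leq_eqVlt => /predU1P[->//|]; rewrite ltnS => cc' ltic.
  rewrite YS nth_cat size_Y (leq_trans ltic) ?leq_exp2l//; exact: IHc'.
pose X i := nth false (Y i.+1) i.
have XY c i : i < Q ^ c -> X i = nth false (Y c) i.
  move=> ltic; rewrite /X -(@leY c (maxn c i.+1)) ?leq_maxl//.
  rewrite -(@leY i.+1 (maxn c i.+1)) ?leq_maxr//.
  by apply: ltn_trans (ltnSn i) _; exact: ltn_expl.
have restrX n c : n <= Q ^ c -> restr X n = take n (Y c).
  move=> lenc; apply: (@eq_from_nth _ false).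
    by rewrite size_restr size_take_min size_Y; lia.
  move=> i; rewrite size_restr => ltin; rewrite nth_mkseq// nth_take//.
  by apply: XY; lia.
exists X; split=> [c Pc|i Xi].
  rewrite /block_top -/Q (@restrX _ c.+1); last first.
    by rewrite expnS leq_mul2r /Q; apply/orP; right; nia.
  have Eq : q * Q ^ c = Q ^ c + q.-1 * Q ^ c by nia.
  rewrite YS take_cat size_Y ltnNge {1}Eq leq_addr /=.
  rewrite {1}Eq addKn take_size_cat ?size_rnd// /rnd Pc.
  exact: K_tau.
have i0 : 0 < i by case: i Xi => //; rewrite (XY 0).
set c := trunc_log Q i.
have /andP[le_i lt_i] : Q ^ c <= i < Q ^ c.+1 by exact: trunc_log_bounds.
move: Xi; rewrite (XY c.+1) // YS nth_cat size_Y ltnNge le_i /=.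
rewrite nth_cat size_rnd; case: ltnP => [lt_ic|_]; last first.
  by rewrite nth_nseq if_same.
rewrite /rnd; case: (P c) => [_|]; last by rewrite nth_nseq if_same.
by rewrite /block_top -/Q; split=> //; nia.
Qed.

Lemma str_code_restrS X k :
  str_code (restr X k.+1) = str_code (restr X k) + 2 ^ k * (X k).+1.
Proof.
by rewrite /restr mkseqS -cats1 str_code_cat -/(restr X k) size_restr.
Qed.

Lemma computable_str_code_restr A :
  computable_in A (fun k => str_code (restr A k)).
Proof.
apply: (@eq_computable _
  (fun k => iteri k (fun i u => u + 2 ^ i * (A i).+1) 0)).
  by elim=> [//|k IHk]; rewrite str_code_restrS -IHk.
by apply: computable_iteri; computability.
Qed.

Lemma hatPi01_block_tops A q : 1 < q ->
  hatPi01 A (range (fun k => block_top q (str_code (restr A k)))).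
Proof.
move=> q1; set p := fun k => _.
have cp : computable_in A p.
  by have := computable_str_code_restr A; rewrite /p /block_top; computability.
have ltp : {homo p : m n / m < n}.
  apply: homo_ltn; first exact: ltn_trans.
  move=> k; rewrite /p /block_top ltn_pmul2l ?(ltnW q1)// ltn_exp2l; last nia.
  by rewrite str_code_restrS -[X in X < _]addn0 ltn_add2l muln_gt0 expn_gt0.
split; last by exists p, p.
- have injp : injective p.
    by move=> k k'; case: (ltngtP k k') => // /ltp + E; rewrite E ltnn.
  have /eq_finite_set Efin :=
    inj_card_eq (in2W injp : {in setT &, injective p}).
  by rewrite Efin; exact: infinite_nat.
- exact: ce_in_compl_range.
Qed.

Lemma exp2_gt_linear d L : d + 8 <= L -> 16 * L.+1 + 4 * d <= 2 ^ L.
Proof.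
move=> dL; have : 20 * L <= 2 ^ L + 16.
  have : 8 <= L by lia.
  elim: L {dL} => // L IHL; rewrite leq_eqVlt => /predU1P[<-//|].
  by rewrite ltnS => /[dup] L8 /IHL; rewrite expnS; lia.
lia.
Qed.

Lemma complexity_off_blocks U (P : pred nat) q (X : nat -> bool) :
    universal_prefix_free U -> 15 < q ->
    (forall i, X i ->
       P (trunc_log (q ^ 2) i) /\ i < block_top q (trunc_log (q ^ 2) i)) ->
  exists n0, forall n, n0 <= n -> ~~ P (trunc_log (q ^ 2) n) ->
    2 * K U (restr X n) <= n.
Proof.
move=> hU q15 XP; set Q := q ^ 2; have Q1 : 1 < Q by rewrite /Q; nia.
have [d dP] := exists_description_restr hU.
exists (Q + 2 ^ (d + 8)) => n le_n nPn.
set c := trunc_log Q n in nPn.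
have n0 : 0 < n by lia.
have c0 : 0 < c by rewrite /c trunc_log_gt0; lia.
pose l := block_top q c.-1.
have [|t /(K_spec hU _).2 le_K le_t] := dP X n l.
  move=> i lt_in /XP[]; rewrite -/Q => Pi /leq_trans; apply.
  rewrite leq_mul2l; apply/orP; right; rewrite leq_exp2l//.
  rewrite -ltnS prednK// ltn_neqAle; apply/andP; split; last first.
    by apply: leq_trunc_log; exact: ltnW.
  by apply: contraNneq nPn => <-.
have le_l : q * l <= n.
  have -> : q * l = Q ^ c.
    by rewrite /l /block_top mulnA mulnn -expnS prednK.
  exact: trunc_logP.
have L2 : 2 ^ trunc_log 2 n <= n by exact: trunc_logP.
have /exp2_gt_linear : d + 8 <= trunc_log 2 n.
  by apply: trunc_log_max => //; lia.
have : 16 * l <= n by nia.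
lia.
Qed.

Lemma dim_block_tops (R : realType) U q (A X : nat -> bool) : 1 < q ->
    (forall k, q.-1 * (q ^ 2) ^ str_code (restr A k)
       <= K U (restr X (block_top q (str_code (restr A k))))) ->
  (((q.-1)%:R / q%:R)%:E <= dim_si_hatPi01 R U A X)%E.
Proof.
move=> q1 KX; apply: le_trans; last first.
  exact: ereal_sup_ubound (imageP _ (hatPi01_block_tops A q1)).
apply: le_ereal_inf_tmp => _ [_ [k _ <-] <-]; rewrite lee_fin.
set c := str_code (restr A k).
have Q0 : 0 < (q ^ 2) ^ c by rewrite !expn_gt0; lia.
have q0 : 0 < q by lia.
rewrite ler_pdivlMr ?ltr0n ?muln_gt0 ?q0// /block_top.
rewrite natrM mulrA mulfVK ?pnatr_eq0 -?lt0n// -natrM ler_nat.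
exact: KX.
Qed.

Lemma dim_gt_half_escape (R : realType) U (B X : nat -> bool) :
    ((2^-1)%:E < dim_si_hatPi01 R U B X)%E ->
  exists2 S, hatPi01 B S &
    forall n, S n -> 0 < n -> n < 2 * K U (restr X n).
Proof.
move=> /ereal_sup_gt[_ [S BS <-] ltS]; exists S => // n Sn n0.
have := lt_le_trans ltS (ereal_inf_lbound _); move=> /(_ _ (imageP _ Sn)).
rewrite lte_fin ltr_pdivlMr ?ltr0n// mulrC ltr_pdivrMr ?ltr0n// -natrM ltr_nat.
by rewrite mulnC.
Qed.

Theorem mainTheorem7 (R : realType) (U : machine)
    (hU : universal_prefix_free U) (A B : nat -> bool) :
  Turing_le A B <->
  forall X : nat -> bool,
    (dim_si_hatPi01 R U A X <= dim_si_hatPi01 R U B X)%E.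
Proof.
split=> [AB X|dimAB].
  apply: ereal_sup_le => _ [N AN <-]; exists N => //.
  exact: hatPi01_subset AB _ AN.
pose P c := `[< exists k, c = str_code (restr A k) >].
have [X [KX XP]] := @exists_block_incompressible U P 16 hU isT.
have [n0 n0P] := complexity_off_blocks hU (isT : 15 < 16) XP.
have ltB : ((2^-1)%:E < dim_si_hatPi01 R U B X)%E.
  apply: lt_le_trans (dimAB X).
  apply: lt_le_trans (@dim_block_tops R U 16 A X isT _).
    rewrite lte_fin ltr_pdivlMr ?ltr0n// mulrC ltr_pdivrMr ?ltr0n//.
    by rewrite -natrM ltr_nat.
  by move=> k; apply: KX; apply/asboolP; exists k.
have [S BS ltS] := dim_gt_half_escape ltB.
apply: (@Turing_le_of_blocks (16 ^ 2) A B S n0.+1) => // n Sn lt_n.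
have [/asboolP//|nP] := boolP (P (trunc_log (16 ^ 2) n)).
have := n0P n (ltnW lt_n) nP; rewrite leqNgt ltS//.
exact: leq_trans lt_n.
Qed.
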